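(* Let $P\in\mathbf{RH}_\infty$ be scalar. If there exists a discrete-time LTI Zames--Falb multiplier $M$ such that $$\mathrm{Re}\{M(z)P(z)\}>0\quad\text{for all }|z|=1,$$ then there exists a finite impulse response (FIR) Zames--Falb multiplier $M_{\mathrm{FIR}}$ such that $$\mathrm{Re}\{M_{\mathrm{FIR}}(z)P(z)\}>0\quad\text{for all }|z|=1.$$
   Context: $\mathbf{RH}_\infty$ is the space of real rational transfer functions with all poles strictly inside the unit circle. A discrete-time SISO LTI Zames--Falb multiplier is an LTI convolution operator $M:\ell_2(\mathbb{Z})\to\ell_2(\mathbb{Z})$ whose real impulse response $m:\mathbb{Z}\to\mathbb{R}$ satisfies $\sum_{i=-\infty}^{\infty}|m_i|<2m_0$; its transfer function on the unit circle is $M(z)=\sum_{i=-\infty}^{\infty}m_iz^{-i}$. It is FIR if $M(z)=\sum_{i=-n_f}^{n_b}m_iz^{-i}$ for some integers $n_f,n_b\ge 0$ (i.e. only finitely many $m_i$ are nonzero). *)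

(* Defs.v *)
From HB Require Import structures.
From mathcomp Require Import all_boot all_order all_algebra.
From mathcomp Require Import all_classical all_reals all_analysis.
From mathcomp Require Import complex.

Set Implicit Arguments.
Unset Strict Implicit.
Unset Printing Implicit Defensive.
Import Order.TTheory GRing.Theory Num.Theory.
Import numFieldNormedType.Exports.
Local Open Scope classical_set_scope.
Local Open Scope ring_scope.
Local Open Scope complex_scope.

(* Used below only for absolutely summable families, for which the way the two
   tails are summed is irrelevant.  Recall that [Negz n] is [- n.+1]. *)
Definition bisum (K : numFieldType) (f : int -> K) : K :=
  limn (series (fun n : nat => f (Posz n))) +
  limn (series (fun n : nat => f (Negz n))).

Definition ell2 (R : realType) : Type :=
  {u : int -> R | (\esum_(k in [set: int]) ((u k) ^+ 2)%:E < +oo)%E}.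

(* By Young's inequality every summable impulse response does induce a unique
   map [ell2 R -> ell2 R], so [zf_op] and [zf_convolution] do not restrict the
   admissible impulse responses. *)
Record zames_falb (R : realType) := ZamesFalb {
  zf_op : ell2 R -> ell2 R;
  zf_impulse : int -> R;
  zf_convolution : forall (u : ell2 R) (k : int),
    sval (zf_op u) k = bisum (fun i : int => zf_impulse i * sval u (k - i));
  zf_dominant :
    (\esum_(i in [set: int]) `|zf_impulse i|%:E < (2 * zf_impulse 0)%:E)%E
}.

Definition zf_transfer (R : realType) (M : zames_falb R) (z : R[i]) : R[i] :=
  bisum (fun i : int => (zf_impulse M i)%:C * z ^ (- i)).

Definition fir (R : realType) (M : zames_falb R) : Prop :=
  exists nf nb : nat, forall i : int,
    ~~ (- (nf%:Z) <= i <= nb%:Z) -> zf_impulse M i = 0.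

(* A rational function is given in lowest terms, so that its finite poles are
   exactly the complex roots of the denominator; [rh_proper] says that there is
   no pole at infinity. *)
Record rh_infty (R : realType) := RHInfty {
  rh_num : {poly R};
  rh_den : {poly R};
  rh_coprime : coprimep rh_num rh_den;
  rh_proper : (size rh_num <= size rh_den)%N;
  rh_stable : forall z : R[i],
    root (map_poly (real_complex R) rh_den) z -> `|z| < 1
}.

Definition rh_eval (R : realType) (P : rh_infty R) (z : R[i]) : R[i] :=
  (map_poly (real_complex R) (rh_num P)).[z] /
  (map_poly (real_complex R) (rh_den P)).[z].

(* Main.v *)
From HB Require Import structures.
Require Import Defs.
From mathcomp Require Import all_boot all_order all_algebra.
From mathcomp Require Import all_classical all_reals all_analysis.
From mathcomp Require Import complex lra zify.
Import Order.TTheory GRing.Theory Num.Theory.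
Import numFieldNormedType.Exports.
Set Implicit Arguments.
Unset Strict Implicit.
Unset Printing Implicit Defensive.
Local Open Scope classical_set_scope.
Local Open Scope ring_scope.
Local Open Scope complex_scope.

(** Truncate the impulse response [m] of the given multiplier symmetrically, at
    a large enough level.  The absolute sum can only decrease and [m 0] is
    kept, so every such truncation is again a Zames--Falb multiplier; it
    remains to choose one level that works for all [z] on the unit circle.

    Write [M_N] for the partial sum of [M] over the first [N] terms of each
    tail and [t_N] for the part of the absolute sum of [m] that [M_N] omits.
    On the circle every term has modulus [`|m i|], so the partial sums converge
    ([cvg_zf_transfer]), and passing from [N] to [N.+1] changes
    [Re (M_N(z) P(z))] by at most [(t_N - t_{N+1}) |P(z)|].  Hence the guaranteed
    margin [Re (M_N(z) P(z)) - t_N |P(z)|] is nondecreasing in [N]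
    ([margin_nondecreasing]); it is continuous in [z], as [P] has no pole on the
    circle ([margin_continuous]), and tends to [Re (M(z) P(z)) > 0]
    ([cvg_margin]).  So the open sets where the margin is positive increase with
    [N] and cover the circle, which is compact ([unit_circle_compact]): one of
    them contains the circle ([compact_nondecreasing_pos]).  There
    [Re (M_N P)] is positive, being at least the margin ([margin_le]).

    A multiplier also carries its convolution operator on square summable
    sequences.  For a finite impulse response this operator is a finite
    combination of shifts, which preserves square summability
    ([square_summable_convolution]). *)

(** * Topology of the complex plane *)

(** The topology of a numeric field, attached to the type of complex numbers
    itself, so that it is found for sets and functions on [R[i]]. *)
HB.instance Definition _ (R : realType) :=
  NormedModule.copy R[i] ((R[i] : numFieldType) : Type).

(** Lets instance resolution succeed when the point is known only as an element
    of the underlying neighbourhood space of [R[i]]. *)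
#[local] Instance complex_nbhs_filter (R : realType) (z : R[i]) :
  Filter (nbhs z) := nbhs_filter z.

Lemma ReD (R : realType) (a b : R[i]) :
  complex.Re (a + b) = complex.Re a + complex.Re b.
Proof. by case: a b => [? ?] [? ?]. Qed.

Lemma le_Re (R : realType) (a b : R[i]) :
  a <= b -> complex.Re a <= complex.Re b.
Proof. by rewrite lecE => /andP[]. Qed.

Lemma norm_Re_le (R : realType) (z : R[i]) :
  `|complex.Re z| <= complex.Re `|z|.
Proof. exact: le_Re (normc_ge_Re z). Qed.

Lemma Re_continuous (R : realType) : continuous (@complex.Re R : R[i] -> R).
Proof.
move=> z; apply/cvgrPdist_le => e e0.
near=> w.
have -> : complex.Re z - complex.Re w = complex.Re (z - w).
  by rewrite ReD; congr (_ + _); case: (w).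
apply: le_trans (norm_Re_le _) _.
rewrite -[e]/(complex.Re e%:C); apply: le_Re.
near: w; apply: cvgr_dist_le; first exact: cvg_id.
by rewrite ltcR.
Unshelve. all: by end_near. Qed.

Lemma cvg_Re (R : realType) (T : Type) (F : set_system T) {FF : Filter F}
    (f : T -> R[i]) (a : R[i]) :
  f x @[x --> F] --> a -> complex.Re (f x) @[x --> F] --> complex.Re a.
Proof. by move=> fa; apply: continuous_cvg => //; exact: Re_continuous. Qed.

Lemma real_complex_continuous (R : realType) :
  continuous (real_complex R : R -> R[i]).
Proof.
move=> x; apply/cvgrPdist_le => - [e b] e0.
have [r r0 re] : exists2 r : R, 0 < r & e +i* b = r%:C.
  by move: e0; rewrite ltcE /= => /andP[/eqP -> a0]; exists e.
near=> y.
rewrite -rmorphB normc_def /= expr0n addr0 sqrtr_sqr re lecR.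
near: y; apply: cvgr_dist_le; first exact: cvg_id. exact: r0.
Unshelve. all: by end_near. Qed.

Lemma cvg_complex (R : realType) (T : Type) (F : set_system T) {FF : Filter F}
    (u v : T -> R) (a b : R) :
  u x @[x --> F] --> a -> v x @[x --> F] --> b ->
  (u x +i* v x : R[i]) @[x --> F] --> (a +i* b : R[i]).
Proof.
move=> ua vb.
have E (x y : R) : x +i* y = x%:C + 'i%C * y%:C by rewrite [LHS]complexE.
rewrite E; under eq_fun do rewrite E.
apply: cvgD; last apply: cvgM; first 2 last.
- by apply: continuous_cvg => //; exact: real_complex_continuous.
- by apply: continuous_cvg => //; exact: real_complex_continuous.
- exact: cvg_cst.
Qed.

(** The circle is the image of [`[- pi, pi]] under [t |-> cos t + i sin t]. *)
Lemma unit_circle_compact (R : realType) :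
  compact [set z : R[i] | `|z| = 1].
Proof.
pose w (t : R) : R[i] := cos t +i* sin t.
have wc : continuous w.
  by move=> t; apply: cvg_complex; [exact: continuous_cos|exact: continuous_sin].
suff -> : [set z : R[i] | `|z| = 1] = w @` `[- pi, pi].
  apply: continuous_compact; last exact: segment_compact.
  exact: continuous_subspaceT.
apply/seteqP; split => [[x y] /= | _ [t _ <-] /=]; last first.
  by rewrite normc_def /= cos2Dsin2 sqrtr1.
rewrite normc_def /= => /complexI xy1.
have xy2 : x ^+ 2 + y ^+ 2 = 1.
  by rewrite -[LHS]sqr_sqrtr ?xy1 ?expr1n // addr_ge0 ?sqr_ge0.
have x1 : -1 <= x <= 1.
  by rewrite -ler_norml -(@ler_pXn2r _ 2) ?nnegrE // real_normK ?num_real //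
     expr1n -xy2 lerDl sqr_ge0.
have sE : sin (acos x) = `|y|.
  by rewrite sin_acos // -xy2 addrC addKr sqrtr_sqr.
have cE := acosK x1.
(* [acos x] is the argument of a point of the upper half circle; the lower
   half is reached by [- acos x]. *)
have [y0|y0] := leP 0 y.
  exists (acos x).
    by rewrite /= in_itv /= acos_lepi // andbT (le_trans _ (acos_ge0 x1)) //
       oppr_le0 pi_ge0.
  by rewrite /w cE sE ger0_norm.
exists (- acos x).
  by rewrite /= in_itv /= lerN2 acos_lepi //= (le_trans _ (pi_ge0 _)) //
     oppr_le0 acos_ge0.
by rewrite /w cosN sinN cE sE ltr0_norm // opprK.
Qed.

(** Dini's argument: positivity of [g N] at a point spreads to a neighbourhood by
    continuity and to all larger indices by monotonicity, and compactness leaves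
    finitely many neighbourhoods.  Monotonicity is available only on [A], so the
    property that spreads is the positivity restricted to [A]. *)
Lemma compact_nondecreasing_pos (R : realType) (T : topologicalType)
    (A : set T) (g : nat -> T -> R) :
  compact A ->
  (forall n x, A x -> {for x, continuous (g n)}) ->
  (forall x, A x -> nondecreasing_seq (fun n => g n x)) ->
  (forall x, A x -> exists n, 0 < g n x) ->
  \forall n \near \oo, forall x, A x -> 0 < g n x.
Proof.
move=> /compact_near_coveringP cA gc gnd gpos.
suff : \forall n \near \oo, A `<=` (fun x => A x -> 0 < g n x).
  by apply: filterS => n h x Ax; exact: (h x Ax Ax).
apply: cA => x Ax; have [N gN] := gpos x Ax.
have nearN : \forall y \near x, 0 < g N y.
  by apply: (cvgr_gt (g N x)) => //; exact: gc.
exists ([set y | 0 < g N y], [set n | (N <= n)%N]).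
  by split => //=; exists N.
move=> [y n] [/= gNy Nn] Ay.
exact: lt_le_trans gNy (gnd _ Ay _ _ Nn).
Qed.

(** * Symmetric partial sums of two-sided series *)

(** The partial sums whose limit is [bisum f]: indices [- N, ..., N - 1]. *)
Definition bipartial (K : numFieldType) (f : int -> K) (N : nat) : K :=
  series (fun n => f (Posz n)) N + series (fun n => f (Negz n)) N.

Lemma bipartialS (K : numFieldType) (f : int -> K) N :
  bipartial f N.+1 = bipartial f N + (f (Posz N) + f (Negz N)).
Proof. by rewrite /bipartial /series /= !big_nat_recr //= addrACA. Qed.

Lemma cvg_bipartial (K : numFieldType) (f : int -> K) :
  cvgn (series (fun n => f (Posz n))) -> cvgn (series (fun n => f (Negz n))) ->
  bipartial f n @[n --> \oo] --> bisum f.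
Proof. by move=> fp fn; apply: cvgD. Qed.

(** The indices over which [bipartial f N] sums. *)
Definition window (N : nat) : pred int :=
  fun i => match i with Posz n | Negz n => (n < N)%N end.

Definition truncate (V : zmodType) (N : nat) (f : int -> V) (i : int) : V :=
  if window N i then f i else 0.

Lemma bisum_window (K : numFieldType) (N : nat) (f : int -> K) :
  (forall i, ~~ window N i -> f i = 0) -> bisum f = bipartial f N.
Proof.
move=> f0.
have series_stop (g : nat -> K) : (forall n, (N <= n)%N -> g n = 0) ->
    limn (series g) = series g N.
  move=> g0; apply: lim_near_cst; first exact: norm_hausdorff.
  exists N => // n /= Nn.
  rewrite /series /= (big_cat_nat (n := N)) //= [X in _ + X]big_nat_cond.
  by rewrite [X in _ + X]big1 ?addr0 // => i /andP[/andP[Ni _] _]; exact: g0.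
by congr (_ + _); apply: series_stop => n Nn; apply: f0; rewrite /= -leqNgt.
Qed.

Lemma eq_bipartial_window (K : numFieldType) (N : nat) (f g : int -> K) :
  (forall i, window N i -> f i = g i) -> bipartial f N = bipartial g N.
Proof.
by move=> fg; congr (_ + _); apply: eq_big_nat => n /andP[_ nN]; exact: fg.
Qed.

(** The partial sums along [h] are sums over finite sets of indices, hence
    bounded by the unordered sum. *)
Lemma esum_injective_cvg (R : realType) (a : int -> R) (h : nat -> int) :
  injective h -> (\esum_(i in [set: int]) `|a i|%:E < +oo)%E ->
  cvgn (series (fun n => `|a (h n)|)).
Proof.
move=> hI afin; apply: nondecreasing_is_cvgn.
  by apply/nondecreasing_seqP => n; rewrite seriesSr lerDl.
exists (fine (\esum_(i in [set: int]) `|a i|%:E)%E) => _ [n _ <-].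
rewrite -lee_fin fineK; last first.
  by rewrite ge0_fin_numE //; apply: esum_ge0 => i _; rewrite lee_fin.
apply: esum_ge; exists (h @` `I_n).
  by split=> //; exact/finite_image/finite_II.
rewrite (reindex_fsbig h `I_n) //; last first.
  by apply: inj_bij => x y _ _ /hI.
by rewrite -fsbig_ord /series /= big_mkord sumEFin.
Qed.

(** Real and imaginary parts converge absolutely by comparison with [b]. *)
Lemma dominated_series_cvg (R : realType) (f : nat -> R[i]) (b : nat -> R) :
  (forall n, `|f n| <= (b n)%:C) -> cvgn (series b) -> cvgn (series f).
Proof.
move=> fb bc.
have part (p : R[i] -> R) : (forall z, `|p z| <= complex.Re `|z|) ->
    cvgn (series (p \o f)).
  move=> pz; apply: normed_cvg.
  have le n : `|p (f n)| <= b n.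
    exact: le_trans (pz _) (le_Re (fb n)).
  apply: (series_le_cvg _ _ _ bc) => n /=.
  - exact: normr_ge0.
  - exact: le_trans (normr_ge0 _) (le n).
  - exact: le.
have ReC := part (@complex.Re R) (@norm_Re_le R).
have ImC : cvgn (series (@complex.Im R \o f)).
  apply: part => -[x y] /=.
  by rewrite -sqrtr_sqr ler_wsqrtr // lerDr sqr_ge0.
apply/cvg_ex; eexists.
have -> : series f = fun n =>
    series (@complex.Re R \o f) n +i* series (@complex.Im R \o f) n.
  apply/funext => n; rewrite /series /=; elim: n => [|n IH].
    by rewrite !big_geq.
  by rewrite !big_nat_recr //= IH; case: (f n).
exact: cvg_complex ReC ImC.
Qed.

(** * Truncated multipliers *)

Definition square_summable (R : realType) (u : int -> R) : Prop :=
  (\esum_(k in [set: int]) ((u k) ^+ 2)%:E < +oo)%E.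

Lemma square_summable_shift (R : realType) (u : int -> R) (i : int) :
  square_summable u -> square_summable (fun k => u (k - i)).
Proof.
rewrite /square_summable (@reindex_esum R _ _ setT setT (fun k => k - i)) //.
split=> [k _ //|k l _ _ /addIr //|k _].
by exists (k + i) => //=; rewrite addrK.
Qed.

Lemma square_summableZ (R : realType) (c : R) (u : int -> R) :
  square_summable u -> square_summable (fun k => c * u k).
Proof.
rewrite /square_summable => ufin.
have sq0 k : (0 <= ((u k) ^+ 2)%:E)%E by rewrite lee_fin sqr_ge0.
apply: (@le_lt_trans _ _
    ((c ^+ 2)%:E * \esum_(k in [set: int]) ((u k) ^+ 2)%:E)%E).
  apply: ub_ereal_sup => _ [A AS <-].
  under eq_fsbigr do rewrite exprMn EFinM.
  rewrite -ge0_mule_fsumr //; apply: lee_wpmul2l.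
    by rewrite lee_fin sqr_ge0.
  by apply: esum_ge; exists A.
by rewrite lte_mul_pinfty ?lee_fin ?sqr_ge0.
Qed.

(** By [(a + b)^2 <= 2 a^2 + 2 b^2], bounded here by [(2 a)^2 + (2 b)^2]. *)
Lemma square_summableD (R : realType) (u v : int -> R) :
  square_summable u -> square_summable v ->
  square_summable (fun k => u k + v k).
Proof.
move=> /(square_summableZ 2) u2 /(square_summableZ 2) v2.
apply: (@le_lt_trans _ _ (\esum_(k in [set: int])
    (((2 * u k) ^+ 2)%:E + ((2 * v k) ^+ 2)%:E))%E).
  by apply: le_esum => k _; rewrite -EFinD lee_fin; nra.
rewrite esumD; first exact: lte_add_pinfty.
all: by move=> k _; rewrite lee_fin sqr_ge0.
Qed.

Lemma square_summable_series (R : realType) (h : nat -> int -> R) (N : nat) :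
  (forall n, square_summable (h n)) ->
  square_summable (fun k => series (h ^~ k) N).
Proof.
move=> hs; elim: N => [|N IH].
  rewrite /square_summable esum1 ?ltry // => k _.
  by rewrite /series /= big_geq // expr0n.
have -> : (fun k => series (h ^~ k) N.+1) = (fun k => h N k + series (h ^~ k) N).
  by apply/funext => k; rewrite seriesSr addrC.
exact: square_summableD.
Qed.

(** The convolution is a finite sum of scaled shifts of [u]. *)
Lemma square_summable_convolution (R : realType) (N : nat) (m u : int -> R) :
  (forall i, ~~ window N i -> m i = 0) -> square_summable u ->
  square_summable (fun k => bisum (fun i => m i * u (k - i))).
Proof.
move=> m0 us.
have -> : (fun k => bisum (fun i => m i * u (k - i))) =
          (fun k => bipartial (fun i => m i * u (k - i)) N).
  by apply/funext => k; apply: bisum_window => i /m0 ->; rewrite mul0r.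
by apply: square_summableD; apply: square_summable_series => n;
  apply: square_summableZ; exact: square_summable_shift.
Qed.

Lemma truncate_dominant (R : realType) (N : nat) (m : int -> R) :
  (\esum_(i in [set: int]) `|m i|%:E < (2 * m 0)%:E)%E ->
  (\esum_(i in [set: int]) `|truncate N.+1 m i|%:E
     < (2 * truncate N.+1 m 0)%:E)%E.
Proof.
apply: le_lt_trans; apply: le_esum => i _; rewrite lee_fin /truncate.
by case: ifP => //; rewrite normr0.
Qed.

Lemma truncate0 (V : zmodType) (N : nat) (f : int -> V) i :
  ~~ window N i -> truncate N f i = 0.
Proof. by rewrite /truncate => /negbTE ->. Qed.

(** The window [N.+1] is never empty, so it always contains the index [0] whose
    coefficient must survive for the dominance condition. *)
Definition zf_truncate (R : realType) (M : zames_falb R) (N : nat) :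
    zames_falb R :=
  @ZamesFalb R
    (fun u => exist _ _ (@square_summable_convolution R N.+1 _ _
                           (@truncate0 _ N.+1 (zf_impulse M)) (svalP u)))
    (truncate N.+1 (zf_impulse M))
    (fun u k => erefl)
    (truncate_dominant N (zf_dominant M)).

Lemma zf_truncate_fir (R : realType) (M : zames_falb R) (N : nat) :
  fir (zf_truncate M N).
Proof.
exists N.+1, N.+1 => i iN; apply: truncate0; apply: contra iN.
by case: i => n /= nN; lia.
Qed.

(** The terms of the series defining [zf_transfer M z]. *)
Definition zf_term (R : realType) (M : zames_falb R) (z : R[i]) (i : int) :
    R[i] := (zf_impulse M i)%:C * z ^ (- i).

Lemma zf_transfer_truncate (R : realType) (M : zames_falb R) (N : nat) z :
  zf_transfer (zf_truncate M N) z = bipartial (zf_term M z) N.+1.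
Proof.
rewrite /zf_transfer (@bisum_window _ N.+1) => [|i iN]; last first.
  by rewrite [zf_impulse _ _]truncate0 // mul0r.
apply: eq_bipartial_window => i iN.
by rewrite /= /truncate iN.
Qed.

(** * Limits of powers, polynomials and partial sums *)

Lemma cvg_exprz (K : numFieldType) (T : Type) (F : set_system T)
    {FF : Filter F} (f : T -> K) (a : K) (i : int) :
  a != 0 -> f x @[x --> F] --> a -> f x ^ i @[x --> F] --> a ^ i.
Proof.
move=> a0 fa.
have cvg_expr (g : T -> K) (b : K) (n : nat) :
    g x @[x --> F] --> b -> g x ^+ n @[x --> F] --> b ^+ n.
  move=> gb; elim: n => [|n IH].
    by rewrite expr0; under eq_fun do rewrite expr0; exact: cvg_cst.
  by rewrite exprS; under eq_fun do rewrite exprS; exact: cvgM.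
case: i => n; first exact: cvg_expr.
rewrite NegzE -exprz_inv; under eq_fun do rewrite -exprz_inv.
by apply: cvg_expr; exact: cvgV.
Qed.

Lemma cvg_horner (K : numFieldType) (T : Type) (F : set_system T)
    {FF : Filter F} (f : T -> K) (a : K) (p : {poly K}) :
  f x @[x --> F] --> a -> p.[f x] @[x --> F] --> p.[a].
Proof.
move=> fa; elim/poly_ind: p => [|p c IH].
  by rewrite horner0; under eq_fun do rewrite horner0; exact: cvg_cst.
rewrite hornerMXaddC; under eq_fun do rewrite hornerMXaddC.
by apply: cvgD; [exact: cvgM|exact: cvg_cst].
Qed.

Lemma cvg_bipartial_term (K : numFieldType) (T : Type) (F : set_system T)
    {FF : Filter F} (f : T -> int -> K) (a : int -> K) (N : nat) :
  (forall i, f x i @[x --> F] --> a i) ->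
  bipartial (f x) N @[x --> F] --> bipartial a N.
Proof.
move=> fa; elim: N => [|N IH].
  have bipartial0 (g : int -> K) : bipartial g 0 = 0.
    by rewrite /bipartial /series /= !big_geq // addr0.
  by rewrite bipartial0; under eq_fun do rewrite bipartial0; exact: cvg_cst.
rewrite bipartialS; under eq_fun do rewrite bipartialS.
by apply: cvgD => //; exact: cvgD.
Qed.

(** Stability keeps the denominator from vanishing on the unit circle. *)
Lemma cvg_rh_eval (R : realType) (P : rh_infty R) (T : Type)
    (F : set_system T) {FF : Filter F} (f : T -> R[i]) (z : R[i]) :
  `|z| = 1 -> f x @[x --> F] --> z ->
  rh_eval P (f x) @[x --> F] --> rh_eval P z.
Proof.
move=> z1 fz.
have den0 : (map_poly (real_complex R) (rh_den P)).[z] != 0.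
  by apply/negP => /(@rh_stable _ P z); rewrite z1 ltxx.
apply: cvgM; first exact: cvg_horner fz.
by apply: (cvgV den0); exact: cvg_horner fz.
Qed.

Lemma norm_unit_exprz (R : realType) (z : R[i]) (i : int) :
  `|z| = 1 -> `|z ^ i| = 1.
Proof.
move=> z1; case: i => n; first by rewrite normrX z1 expr1n.
by rewrite NegzE -exprz_inv normrX normfV z1 invr1 expr1n.
Qed.

(** * The stability margin of a truncation *)

Section Margin.
Variables (R : realType) (M : zames_falb R) (P : rh_infty R).

Let absm (i : int) : R := `|zf_impulse M i|.

Definition impulse_tail (N : nat) : R := bisum absm - bipartial absm N.

(** The value of [Re (M P)] at [z] that the first [N] terms of each tail of [M]
    guarantee, whatever the phases of the omitted terms.  The norm of a complex
    number is itself complex, whence its real part. *)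
Definition margin (N : nat) (z : R[i]) : R :=
  complex.Re (bipartial (zf_term M z) N * rh_eval P z) -
  impulse_tail N * complex.Re `|rh_eval P z|.

Let absm_summable : (\esum_(i in [set: int]) `|zf_impulse M i|%:E < +oo)%E.
Proof. exact: lt_trans (zf_dominant M) (ltry _). Qed.

Let absm_cvgp : cvgn (series (fun n => absm (Posz n))).
Proof. by apply: esum_injective_cvg => // x y []. Qed.

Let absm_cvgn : cvgn (series (fun n => absm (Negz n))).
Proof. by apply: esum_injective_cvg => // x y []. Qed.

Lemma impulse_tail_cvg0 : impulse_tail N @[N --> \oo] --> 0.
Proof.
rewrite -(subrr (bisum absm)); apply: cvgB; first exact: cvg_cst.
exact: cvg_bipartial.
Qed.

Lemma impulse_tail_ge0 N : 0 <= impulse_tail N.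
Proof.
rewrite subr_ge0.
have series_nd (h : nat -> int) : nondecreasing_seq (series (absm \o h)).
  by apply/nondecreasing_seqP => n; rewrite seriesSr lerDl normr_ge0.
by apply: lerD; apply: nondecreasing_cvgn_le => //; exact: series_nd.
Qed.

Lemma norm_zf_term z i : `|z| = 1 -> `|zf_term M z i| = (absm i)%:C.
Proof.
move=> z1; rewrite normrM norm_unit_exprz // mulr1.
by rewrite normc_def /= expr0n addr0 sqrtr_sqr.
Qed.

Lemma cvg_zf_transfer z : `|z| = 1 ->
  bipartial (zf_term M z) N @[N --> \oo] --> zf_transfer M z.
Proof.
move=> z1.
by apply: cvg_bipartial; [apply: dominated_series_cvg absm_cvgp
  | apply: dominated_series_cvg absm_cvgn] => n; rewrite norm_zf_term.
Qed.

Lemma cvg_margin z : `|z| = 1 ->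
  margin N z @[N --> \oo] --> complex.Re (zf_transfer M z * rh_eval P z).
Proof.
move=> z1; rewrite -[X in _ --> X]subr0.
rewrite -[X in _ - X](mul0r (complex.Re `|rh_eval P z|)).
apply: cvgB; last by apply: cvgM; [exact: impulse_tail_cvg0|exact: cvg_cst].
by apply: cvg_Re; apply: cvgM; [exact: cvg_zf_transfer|exact: cvg_cst].
Qed.

(** The increment [d] of the partial sum satisfies
    [- Re (d P) <= |d| |P| <= (t_N - t_{N+1}) |P|], where [t_N] is the tail: the
    tail bound pays for the worst phase of the new terms. *)
Lemma margin_nondecreasing z : `|z| = 1 -> nondecreasing_seq (margin ^~ z).
Proof.
move=> z1; apply/nondecreasing_seqP => N.
set d := zf_term M z (Posz N) + zf_term M z (Negz N).
have dle : `|d| <= (absm (Posz N) + absm (Negz N))%:C.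
  by rewrite rmorphD /= -!(norm_zf_term _ z1) ler_normD.
have := le_Re (ler_wpM2r (normr_ge0 (rh_eval P z)) dle).
rewrite -normrM => dP.
have := le_trans (norm_Re_le _) dP; rewrite ler_norml => /andP[+ _].
rewrite /margin /impulse_tail !bipartialS -/d (mulrDl _ d) ReD.
have -> (a : R) (w : R[i]) : complex.Re (a%:C * w) = a * complex.Re w.
  by case: w => x y /=; rewrite mul0r subr0.
by lra.
Qed.

(** Continuity on the circle, in the form of composition with an arbitrary limit
    converging to [z]. *)
Lemma cvg_margin_comp (T : Type) (F : set_system T) {FF : Filter F}
    (f : T -> R[i]) (z : R[i]) (N : nat) :
  `|z| = 1 -> f x @[x --> F] --> z ->
  margin N (f x) @[x --> F] --> margin N z.
Proof.
move=> z1 fz.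
have z0 : z != 0 by rewrite -normr_eq0 z1 oner_eq0.
have Pz : rh_eval P (f x) @[x --> F] --> rh_eval P z by exact: cvg_rh_eval.
apply: cvgB; last first.
  apply: cvgM; first exact: cvg_cst.
  exact: cvg_Re (cvg_norm Pz).
apply: cvg_Re; apply: (fun H => cvgM H Pz); apply: cvg_bipartial_term => i.
have zi : f x ^ (- i) @[x --> F] --> z ^ (- i).
  exact: (cvg_exprz z0 fz).
exact: (cvgM (cvg_cst (zf_impulse M i)%:C) zi).
Qed.

Lemma margin_continuous N z : `|z| = 1 -> {for z, continuous (margin N)}.
Proof. by move=> z1; apply: (@cvg_margin_comp _ (nbhs z) _ id). Qed.

Lemma margin_le N z :
  margin N z <= complex.Re (bipartial (zf_term M z) N * rh_eval P z).
Proof.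
by rewrite gerBl mulr_ge0 ?impulse_tail_ge0 // -[0]/(complex.Re (0 : R[i])) le_Re.
Qed.

End Margin.

Theorem mainTheorem3 (R : realType) (P : rh_infty R) :
  (exists M : zames_falb R,
     forall z : R[i], `|z| = 1 ->
       0 < complex.Re (zf_transfer M z * rh_eval P z)) ->
  exists M_FIR : zames_falb R,
    fir M_FIR /\
    forall z : R[i], `|z| = 1 ->
      0 < complex.Re (zf_transfer M_FIR z * rh_eval P z).
Proof.
move=> [M MP].
have [N _ posN] : \forall N \near \oo,
    forall z : R[i], `|z| = 1 -> 0 < margin M P N z.
  apply: (compact_nondecreasing_pos (@unit_circle_compact R)).
  - by move=> n z; exact: margin_continuous.
  - by move=> z; exact: margin_nondecreasing.
  - move=> z z1.
    have [n _ pos] := cvgr_gt _ (cvg_margin (P := P) z1) _ (MP z z1).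
    by exists n; exact: pos (leqnn n).
exists (zf_truncate M N); split; first exact: zf_truncate_fir.
move=> z z1; rewrite zf_transfer_truncate.
apply: lt_le_trans (margin_le _ _ _ _).
exact: posN (leqnSn N) z z1.
Qed.
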